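(* For every integer $n\ge15$, there exists a cubic totally silver graph of order $4n$ and girth $9$.
   Context: A totally silver coloring of a graph $G$ is a map $c$ from $V(G)$ to a set of colors such that for every $v\in V(G)$, each color appears exactly once on the closed neighborhood $N[v]$; a graph is totally silver if it admits one. Cubic means $3$--regular; girth is the length of a shortest cycle. *)

(* Defs.v *)
From mathcomp Require Import all_boot.

Set Implicit Arguments.
Unset Strict Implicit.
Unset Printing Implicit Defensive.

Record sgraph := SGraph {
  vertex :> finType;
  adj : rel vertex;
  adj_sym : symmetric adj;
  adj_irrefl : irreflexive adj }.

Definition graph_order (G : sgraph) : nat := #|G|.

Definition open_nbhd (G : sgraph) (v : G) : {set G} := [set u | adj v u].

Definition closed_nbhd (G : sgraph) (v : G) : {set G} := v |: open_nbhd v.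

Definition regular (k : nat) (G : sgraph) : Prop :=
  forall v : G, #|open_nbhd v| = k.

Definition cubic (G : sgraph) : Prop := regular 3 G.

Definition totally_silver_coloring (G : sgraph) (C : Type) (c : G -> C) : Prop :=
  forall (v : G) (k : C), exists! u : G, u \in closed_nbhd v /\ c u = k.

Definition totally_silver (G : sgraph) : Prop :=
  exists (C : Type) (c : G -> C), totally_silver_coloring c.

(* [ucycle] also accepts the empty sequence and a single edge [:: x; y]
   traversed back and forth, hence the bound on the size. *)
Definition is_cycle (G : sgraph) (p : seq G) : Prop :=
  ucycle (@adj G) p /\ 3 <= size p.

Definition has_girth (G : sgraph) (g : nat) : Prop :=
  (exists2 p : seq G, is_cycle p & size p = g) /\
  (forall p : seq G, is_cycle p -> g <= size p).

(* Main.v *)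
Require Import Defs.
From mathcomp Require Import all_boot all_algebra.

(** A covering map pulls regularity and totally silver colorings back from its
    base, and every complete graph is totally silver, so every cover of [K_4] is
    cubic and totally silver.  We take the [n]-fold cyclic cover with voltages
    1, 2, 4 on a triangle [0 -> 1 -> 2 -> 0] and voltage 0 on the three edges
    at 3.  A cycle of the cover projects to a closed reduced walk of [K_4] whose
    total voltage vanishes modulo [n].  By enumeration, the closed reduced walks
    of length at most 8 have nonzero integral voltage of absolute value at most
    14, so for [n >= 15] there is no cycle shorter than 9, whereas some closed
    reduced walk of length 9 has integral voltage 0. *)

Set Implicit Arguments.
Unset Strict Implicit.
Unset Printing Implicit Defensive.

Import GRing.Theory.

Section Sequences.
Variable T : eqType.
Implicit Types (x : T) (s w : seq T).

Fixpoint nonbacktracking s : bool :=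
  if s is x :: s' then (ohead (behead s') != Some x) && nonbacktracking s'
  else true.

Lemma uniq_nonbacktracking s : uniq s -> nonbacktracking s.
Proof.
elim: s => //= x s IHs /andP[xNs /IHs ->]; rewrite andbT.
case: s xNs {IHs} => [|y [|z s]] //=; rewrite !inE !negb_or.
by case/and3P=> _ + _; apply: contraNneq => -[->].
Qed.

Lemma uniq_cycle_nonbacktracking x w :
  uniq (x :: w) -> 1 < size w -> nonbacktracking (x :: rcons w x).
Proof.
case: w => [|y [|z w]] // uniq_xyzw _.
have uniq_yzwx : uniq [:: y, z & rcons w x].
  by rewrite -!rcons_cons rcons_uniq -cons_uniq.
rewrite [nonbacktracking _]/= -/(nonbacktracking [:: y, z & rcons w x]).
rewrite uniq_nonbacktracking // andbT.
by move: uniq_xyzw; apply: contraTneq => -[->]; rewrite /= !inE eqxx orbT.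
Qed.

Fixpoint words s (k : nat) : seq (seq T) :=
  if k is k'.+1 then [seq x :: w | x <- s, w <- words s k'] else [:: [::]].

Lemma mem_words s w : {subset w <= s} -> w \in words s (size w).
Proof.
elim: w => //= x w IHw xw_sub_s; apply: allpairs_f.
  by apply: xw_sub_s; rewrite mem_head.
by apply: IHw => y yw; apply: xw_sub_s; rewrite inE yw orbT.
Qed.

End Sequences.

Definition reduced_walk (G : sgraph) (x : G) (w : seq G) : bool :=
  path (@adj G) x w && nonbacktracking (x :: w).

Lemma cycle_reduced_walk (G : sgraph) (x : G) (w : seq G) :
  is_cycle (x :: w) -> reduced_walk x (rcons w x).
Proof.
case=> /andP[xw_path xw_uniq] size_w.
by rewrite /reduced_walk [path _ _ _]xw_path uniq_cycle_nonbacktracking.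
Qed.

Section CompleteGraph.
Variable T : finType.

Definition complete_adj : rel T := fun x y => x != y.

Lemma complete_adj_sym : symmetric complete_adj.
Proof. by move=> x y; rewrite /complete_adj eq_sym. Qed.

Lemma complete_adj_irrefl : irreflexive complete_adj.
Proof. by move=> x; rewrite /complete_adj eqxx. Qed.

Definition complete_graph : sgraph :=
  SGraph complete_adj_sym complete_adj_irrefl.

Lemma complete_graph_regular : regular #|T|.-1 complete_graph.
Proof.
move=> x; rewrite -(cardsC1 x); congr #|pred_of_set _|.
by apply/setP=> y; rewrite !inE eq_sym.
Qed.

Lemma complete_graph_totally_silver_coloring :
  @totally_silver_coloring complete_graph T id.
Proof.
move=> x y; exists y; split; last by move=> z [_ ->].
by rewrite !inE eq_sym /= /complete_adj; case: eqVneq.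
Qed.

End CompleteGraph.

Definition covering (H G : sgraph) (p : H -> G) : Prop :=
  forall u : H,
    {in open_nbhd u &, injective p} /\ p @: open_nbhd u = open_nbhd (p u).

Section Covering.
Variables (H G : sgraph) (p : H -> G).
Hypothesis p_cov : covering p.

Lemma covering_inj (u v w : H) : adj u v -> adj u w -> p v = p w -> v = w.
Proof. by move=> uv uw; apply: (p_cov u).1; rewrite inE. Qed.

Lemma covering_adj (u v : H) : adj u v -> adj (p u) (p v).
Proof.
move=> uv; suff: p v \in open_nbhd (p u) by rewrite inE.
by rewrite -(p_cov u).2 imset_f // inE.
Qed.

Lemma covering_regular (k : nat) : regular k G -> regular k H.
Proof.
move=> G_reg u; have [p_inj p_im] := p_cov u.
by rewrite -(card_in_imset p_inj) p_im.
Qed.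

Lemma covering_closed_nbhd_inj (u : H) : {in closed_nbhd u &, injective p}.
Proof.
have pNu v : adj u v -> p v <> p u.
  by move=> /covering_adj + pvu; rewrite pvu adj_irrefl.
move=> v w; rewrite !inE => /orP[/eqP->|uv] /orP[/eqP->|uw] //.
- by move/esym/(pNu _ uw).
- by move/(pNu _ uv).
- exact: covering_inj uv uw.
Qed.

Lemma covering_closed_nbhd_imset (u : H) :
  p @: closed_nbhd u = closed_nbhd (p u).
Proof. by rewrite /closed_nbhd imsetU1 (p_cov u).2. Qed.

Lemma covering_totally_silver_coloring (C : Type) (c : G -> C) :
  totally_silver_coloring c -> totally_silver_coloring (c \o p).
Proof.
move=> c_silver u k; have [x [[x_near cx] x_uniq]] := c_silver (p u) k.
move: x_near; rewrite -covering_closed_nbhd_imset => /imsetP[v v_near x_pv].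
exists v; split=> [|w [w_near cw]]; first by rewrite /= -x_pv.
apply: (covering_closed_nbhd_inj v_near w_near).
by rewrite -x_pv; apply: x_uniq; rewrite -covering_closed_nbhd_imset imset_f.
Qed.

Lemma covering_reduced_walk (u : H) (w : seq H) :
  reduced_walk u w -> reduced_walk (p u) (map p w).
Proof.
elim: w u => // v w IHw u /andP[/=/andP[uv vw] /andP[uN vw_red]].
have /andP[pvw_path pvw_red] := IHw v (introT andP (conj vw vw_red)).
apply/andP; split; first by rewrite /= covering_adj.
move: pvw_red => /= ->; rewrite andbT.
case: w vw uN {IHw vw_red pvw_path} => //= t w /andP[vt _].
apply: contraNneq => -[ptu]; apply/eqP; congr Some.
by apply: covering_inj vt _ ptu; rewrite adj_sym.
Qed.

End Covering.

Section NetVoltage.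
Local Open Scope ring_scope.
Variables (T : Type) (A : nmodType).

Fixpoint net_voltage (f : T -> T -> A) (x : T) (w : seq T) : A :=
  if w is y :: w' then f x y + net_voltage f y w' else 0.

End NetVoltage.

Lemma raddf_net_voltage (T : Type) (A B : nmodType) (h : {additive A -> B})
    (f : T -> T -> A) (x : T) (w : seq T) :
  net_voltage (fun y z => h (f y z)) x w = h (net_voltage f x w).
Proof. by elim: w x => [|y w IHw] x /=; rewrite ?raddf0 // IHw raddfD. Qed.

Section VoltageCover.
Local Open Scope ring_scope.
Variables (G : sgraph) (A : finZmodType) (f : G -> G -> A).
Hypothesis f_anti : forall x y, f y x = - f x y.

Definition voltage_cover_adj : rel (G * A) := fun u v =>
  adj u.1 v.1 && (v.2 == u.2 + f u.1 v.1).

Lemma voltage_cover_adj_sym : symmetric voltage_cover_adj.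
Proof.
by move=> u v; rewrite /voltage_cover_adj adj_sym f_anti -subr_eq opprK eq_sym.
Qed.

Lemma voltage_cover_adj_irrefl : irreflexive voltage_cover_adj.
Proof. by move=> u; rewrite /voltage_cover_adj adj_irrefl. Qed.

Definition voltage_cover : sgraph :=
  SGraph voltage_cover_adj_sym voltage_cover_adj_irrefl.

Lemma voltage_cover_order :
  graph_order voltage_cover = (graph_order G * #|A|)%N.
Proof. exact: card_prod. Qed.

Lemma voltage_cover_covering : covering (fun u : voltage_cover => u.1).
Proof.
move=> u; split.
  move=> [x i] [y j]; rewrite !inE => /andP[_ /eqP/= ->] /andP[_ /eqP/= ->].
  by move=> /= ->.
apply/setP=> x; rewrite inE; apply/imsetP/idP => [[v]|ux].
  by rewrite inE => /andP[uv _] ->.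
by exists (x, u.2 + f u.1 x); rewrite // inE /= /voltage_cover_adj /= ux eqxx.
Qed.

Lemma voltage_cover_path_last (u : voltage_cover) (w : seq voltage_cover) :
  path (@adj voltage_cover) u w ->
  (last u w).2 = u.2 + net_voltage f u.1 (map fst w).
Proof.
elim: w u => [|v w IHw] u /=; first by rewrite addr0.
by case/andP=> /andP[_ /eqP v2] /IHw ->; rewrite v2 addrA.
Qed.

Lemma voltage_cover_cycle_size_ge (g : nat) :
  (forall (x : G) (w : seq G), (size (x :: w) < g)%N ->
     reduced_walk x (rcons w x) -> net_voltage f x (rcons w x) != 0) ->
  forall p : seq voltage_cover, is_cycle p -> (g <= size p)%N.
Proof.
move=> short_neq0 [|u w] u_cycle; first by case: u_cycle.
rewrite leqNgt; apply/negP => size_lt.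
have uw_red := cycle_reduced_walk u_cycle.
have /andP[/voltage_cover_path_last] := uw_red.
rewrite last_rcons map_rcons -[LHS]addr0 => /addrI/esym/eqP uw_volt _.
have := covering_reduced_walk voltage_cover_covering uw_red; rewrite map_rcons.
by move/short_neq0/negP; apply; rewrite //= size_map.
Qed.

End VoltageCover.

Lemma Zp_intr_neq0 (n : nat) (m : int) :
  0 < `|m| < n -> (m%:~R != 0 :> 'Z_n)%R.
Proof.
case/andP=> m_gt0 m_lt; have n_gt1 := leq_ltn_trans m_gt0 m_lt.
have abs_neq0 : (`|m|%:R != 0 :> 'Z_n)%R.
  by rewrite -val_eqE /= val_Zp_nat // modn_small // -lt0n.
by rewrite [m]intEsign rmorphMsign mulr_sign; case: ifP; rewrite ?oppr_eq0.
Qed.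

Definition K4 : sgraph := complete_graph 'I_4.

Section CyclicCoverOfK4.
Local Open Scope ring_scope.

Definition K4_voltage (x y : 'I_4) : int :=
  match val x, val y with
  | 0%N, 1%N => 1 | 1%N, 2%N => 2 | 2%N, 0%N => 4
  | 1%N, 0%N => -1 | 2%N, 1%N => -2 | 0%N, 2%N => -4
  | _, _ => 0
  end.

Lemma K4_voltage_anti (x y : 'I_4) : K4_voltage y x = - K4_voltage x y.
Proof. by case: x y => [[|[|[|[|?]]]] ?] [[|[|[|[|?]]]] ?]. Qed.

Lemma K4_short_closed_walk_voltage (x : K4) (w : seq K4) :
  (size (x :: w) < 9)%N -> reduced_walk x (rcons w x) ->
  (0 < `|net_voltage K4_voltage x (rcons w x)| < 15)%N.
Proof.
pose vertices : seq K4 := [:: 0; 1; 2; 3].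
have mem_vertices (y : K4) : y \in vertices by case: y => [[|[|[|[|?]]]] ?].
have all_short : all (fun k => all (fun y : K4 => all (fun v =>
      reduced_walk y (rcons v y) ==>
      (0 < `|net_voltage K4_voltage y (rcons v y)| < 15)%N)
    (words vertices k)) vertices) (iota 0 8) by vm_compute.
move=> size_w xw_red.
have := allP all_short (size w); rewrite mem_iota => /(_ size_w).
move=> /allP/(_ x (mem_vertices x))/allP/(_ w).
by rewrite xw_red; apply; apply: mem_words.
Qed.

Variable n : nat.

Definition K4_voltage_mod (x y : K4) : 'Z_n := (K4_voltage x y)%:~R.

Lemma K4_voltage_mod_anti (x y : K4) :
  K4_voltage_mod y x = - K4_voltage_mod x y.
Proof. by rewrite /K4_voltage_mod K4_voltage_anti rmorphN. Qed.

Definition K4_cyclic_cover : sgraph := voltage_cover K4_voltage_mod_anti.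

Lemma K4_cyclic_cover_covering : covering (fun u : K4_cyclic_cover => u.1).
Proof. exact: voltage_cover_covering. Qed.

Lemma K4_cyclic_cover_cubic : cubic K4_cyclic_cover.
Proof.
apply: covering_regular K4_cyclic_cover_covering _ _.
by have := @complete_graph_regular 'I_4; rewrite card_ord.
Qed.

Lemma K4_cyclic_cover_totally_silver : totally_silver K4_cyclic_cover.
Proof.
exists 'I_4, (fun u => u.1).
exact: covering_totally_silver_coloring K4_cyclic_cover_covering _ _
  (@complete_graph_totally_silver_coloring _).
Qed.

Lemma K4_cyclic_cover_order :
  (1 < n)%N -> graph_order K4_cyclic_cover = (4 * n)%N.
Proof.
by move=> n_gt1; rewrite voltage_cover_order /graph_order !card_ord Zp_cast.
Qed.

Lemma K4_cyclic_cover_cycle_ge9 (p : seq K4_cyclic_cover) :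
  (15 <= n)%N -> is_cycle p -> (9 <= size p)%N.
Proof.
move=> n_ge15; apply: voltage_cover_cycle_size_ge => x w size_w xw_red.
rewrite (raddf_net_voltage intr); apply: Zp_intr_neq0.
have /andP[-> volt_lt] := K4_short_closed_walk_voltage size_w xw_red.
exact: leq_trans volt_lt n_ge15.
Qed.

Lemma K4_cyclic_cover_9cycle :
  (2 < n)%N -> exists2 p : seq K4_cyclic_cover, is_cycle p & size p = 9.
Proof.
move=> n_gt2.
have two_neq0 : 2 != 0 :> 'Z_n by exact: (@Zp_intr_neq0 n 2).
have one_neq2 : 1 != 2 :> 'Z_n by rewrite -subr_eq0 opprD addNKr oppr_eq0.
(* The lift from level 0 of the closed walk 0 1 3 0 1 3 2 1 3 of [K4], whose
   successive voltages are 1, 0, 0, 1, 0, 0, -2, 0, 0. *)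
pose p : seq K4_cyclic_cover :=
  [:: (0, 0); (1, 1); (3, 1); (0, 1); (1, 2); (3, 2); (2, 2); (1, 0); (3, 0)].
exists p => //; split=> //; apply/andP; split.
  rewrite /= /voltage_cover_adj /K4_voltage_mod /=.
  by rewrite ?(add0r, addr0, subrr) !eqxx.
rewrite /= !inE !xpair_eqE /=.
by rewrite !orbF (negPf one_neq2) two_neq0.
Qed.

End CyclicCoverOfK4.

Theorem theorem5p1 (n : nat) (hn : 15 <= n) :
  exists G : sgraph,
    [/\ cubic G, totally_silver G, graph_order G = 4 * n & has_girth G 9].
Proof.
have [n_gt1 n_gt2] : 1 < n /\ 2 < n by split; apply: leq_trans hn.
exists (K4_cyclic_cover n); split.
- exact: K4_cyclic_cover_cubic.
- exact: K4_cyclic_cover_totally_silver.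
- exact: K4_cyclic_cover_order.
- split; first exact: K4_cyclic_cover_9cycle.
  by move=> p; apply: K4_cyclic_cover_cycle_ge9.
Qed.
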